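(* Let $G=(N,\Sigma,R,S)$ be a context-free grammar. Then there exists a test set $T\subseteq L(G)$ for $L(G)$ containing at most $2|G|^3$ words, where $|G| = \sum_{(A\to\mathit{rhs})\in R}(|\mathit{rhs}|+1)$.
   Context: A context-free grammar is $G=(N,\Sigma,R,S)$ with non-terminals $N$, terminals $\Sigma$, productions $R\subseteq N\times(N\uplus\Sigma)^*$ (written $A\to\mathit{rhs}$), start symbol $S$; $L(G)$ is its language and $|\mathit{rhs}|$ is the length of the right-hand side. A morphism $f:\Sigma^*\to\Gamma^*$ satisfies $f(\epsilon)=\epsilon$ and $f(uv)=f(u)f(v)$. For $L\subseteq\Sigma^*$, a subset $T\subseteq L$ is a test set for $L$ if for every alphabet $\Gamma$ and any morphisms $f,g:\Sigma^*\to\Gamma^*$ with $f(w)=g(w)$ for all $w\in T$, we have $f(w)=g(w)$ for all $w\in L$. *)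

(* Defs.v *)
From mathcomp Require Import all_boot.
From Stdlib Require Import Relations.
Set Implicit Arguments. Unset Strict Implicit. Unset Printing Implicit Defensive.

Record cfg (N Sigma : finType) := CFG {
  prods : seq (N * seq (N + Sigma));
  start : N
}.

Definition cfg_step (N Sigma : finType) (G : cfg N Sigma)
  (u v : seq (N + Sigma)) : Prop :=
  exists (x y : seq (N + Sigma)) (A : N) (rhs : seq (N + Sigma)),
    (A, rhs) \in prods G /\ u = x ++ inl A :: y /\ v = x ++ rhs ++ y.

Definition cfg_derives (N Sigma : finType) (G : cfg N Sigma) :=
  clos_refl_trans (seq (N + Sigma)) (@cfg_step N Sigma G).

Definition cfg_lang (N Sigma : finType) (G : cfg N Sigma) (w : seq Sigma) : Prop :=
  cfg_derives G [:: inl (start G)] (map inr w).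

Definition cfg_size (N Sigma : finType) (G : cfg N Sigma) : nat :=
  \sum_(p <- prods G) (size p.2).+1.

Definition is_morphism (Sigma Gamma : Type) (f : seq Sigma -> seq Gamma) : Prop :=
  f [::] = [::] /\ forall u v, f (u ++ v) = f u ++ f v.

Definition is_test_set (Sigma : finType) (L : seq Sigma -> Prop)
  (T : seq (seq Sigma)) : Prop :=
  (forall w, w \in T -> L w) /\
  forall (Gamma : finType) (f g : seq Sigma -> seq Gamma),
    is_morphism f -> is_morphism g ->
    (forall w, w \in T -> f w = g w) ->
    forall w, L w -> f w = g w.

(* Main.v *)
Require Import Defs.
From HB Require Import structures.
From mathcomp Require Import all_boot all_algebra boolp.
From Stdlib Require Import Relations.
From mathcomp Require Import zify ring.

Set Implicit Arguments. Unset Strict Implicit. Unset Printing Implicit Defensive.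

(** The free monoid over a finite alphabet embeds into the affine group of
    [rat], so equations between images of words can be solved in a group, and in
    this group commutation is transitive on nontrivial elements.

    Choosing one word per nonterminal turns the grammar into a linear one: a
    production is replaced by its branches, which keep at most one nonterminal and
    fill in the chosen words elsewhere.  Two morphisms that agree on the words of
    the linear grammar agree on the whole language, because
    [x y = (x y') (x' y')^-1 (x' y)] in a group.

    Words of the linear grammar are walks in a graph with at most [|G|] edges.  If
    a walk is cut into four segments, each of which may be replaced by another walk
    with the same ends, agreement on 15 of the 16 resulting words implies agreement
    on the last one.  Replacing non-least segments by length-lexicographically least
    walks makes a walk smaller, so the only walks needed are those that do not
    split into four non-least segments.  Such a walk consists of at most three edges
    joined by least walks, whence the bound [1 + n + n^2 + n^3]. *)

(** * Numerals and the affine embedding *)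

(* Digits range over 1, ..., #|T|, so that comparing numerals in base #|T| + 1 is
   comparing words length-lexicographically. *)
Definition numeral (T : finType) (s : seq T) : nat :=
  foldl (fun c x => c * #|T|.+1 + (enum_rank x).+1) 0 s.

Lemma numeral_rcons (T : finType) (s : seq T) x :
  numeral (rcons s x) = numeral s * #|T|.+1 + (enum_rank x).+1.
Proof. by rewrite /numeral foldl_rcons. Qed.

Lemma numeral_cat (T : finType) (s t : seq T) :
  numeral (s ++ t) = numeral s * #|T|.+1 ^ size t + numeral t.
Proof.
elim/last_ind: t => [|t x IH]; first by rewrite cats0 muln1 addn0.
rewrite -rcons_cat !numeral_rcons IH size_rcons expnSr; lia.
Qed.

Lemma numeral_inj (T : finType) : injective (@numeral T).
Proof.
elim/last_ind=> [|s x IH] t; case/lastP: t => [|t y] //; rewrite ?numeral_rcons.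
- by rewrite addnS.
- by rewrite addnS.
move=> E.
have Es : numeral s = numeral t.
  have := congr1 (divn^~ #|T|.+1) E.
  by rewrite /= !divnMDl // !divn_small ?ltnS ?ltn_ord // !addn0.
have /enum_rank_inj -> : enum_rank x = enum_rank y by 
  by apply: val_inj; move: E; rewrite Es => /addnI[].
by rewrite (IH _ Es).
Qed.

Lemma numeral_lt (T : finType) (s : seq T) : numeral s < #|T|.+1 ^ size s.
Proof.
elim/last_ind: s => [|s x IH] //; rewrite numeral_rcons size_rcons expnSr.
rewrite -(leq_pmul2r (ltn0Sn #|T|)) in IH; apply: leq_trans IH.
by rewrite mulSn addnC ltn_add2r !ltnS ltn_ord.
Qed.

(** A nonempty word has leading digit at least 1; the last summand makes up for the empty word. *)
Lemma numeral_ge (T : finType) (s : seq T) :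
  #|T|.+1 ^ size s <= #|T|.+1 * numeral s + (s == [::]).
Proof.
elim/last_ind: s => [|s x IH]; first by rewrite expn0 eqxx addn1.
rewrite numeral_rcons size_rcons expnSr.
apply: leq_trans (leq_addr _ _); rewrite mulnDr.
case: eqP IH => [->|_] IH; last first.
  by rewrite addn0 in IH; rewrite mulnA (leq_trans _ (leq_addr _ _)) // leq_mul.
by rewrite mul1n; apply: leq_trans (leq_addl _ _); rewrite leq_pmulr.
Qed.

Lemma numeral_size (T : finType) (s t : seq T) :
  numeral s <= numeral t -> size s <= size t.
Proof.
move=> le_st; case: (eqVneq s [::]) => [-> //|s0].
have := numeral_ge s; rewrite (negPf s0) addn0 => ge_s.
have lt_t := numeral_lt t.
rewrite -ltnS -(@ltn_exp2l #|T|.+1); last first.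
  by rewrite ltnS; case: s s0 {ge_s le_st} => // x s _; apply/card_gt0P; exists x.
rewrite expnS; apply: leq_ltn_trans ge_s _; rewrite ltn_pmul2l //.
exact: leq_ltn_trans lt_t.
Qed.

(** A smaller numeral never belongs to a longer word, so shrinking either factor shrinks the
    whole. *)
Lemma numeral_leqif_cat (T : finType) (s s' t t' : seq T) C D :
  numeral s <= numeral s' ?= iff C -> numeral t <= numeral t' ?= iff D ->
  numeral (s ++ t) <= numeral (s' ++ t') ?= iff C && D.
Proof.
move=> [le_s <-] [le_t <-]; rewrite !numeral_cat; split.
  by rewrite leq_add // leq_mul // leq_pexp2l // numeral_size.
have le_e : #|T|.+1 ^ size t <= #|T|.+1 ^ size t' by rewrite leq_pexp2l ?numeral_size.
have gt0 : 0 < #|T|.+1 ^ size t' by rewrite expn_gt0.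
apply/eqP/andP=> [E|[/eqP/numeral_inj-> /eqP/numeral_inj->] //].
by split; apply/eqP; nia.
Qed.

Definition commutation_transitive (gT : groupType) :=
  forall x y z : gT, y != 1%g -> commute x y -> commute y z -> commute x z.

(** * The affine group of a field *)

Section Affine.
Import GRing.Theory.
Local Open Scope ring_scope.

(* The pair [(a, b)] stands for the map x |-> x * a + b; maps act on the
   right, so that the product is composition read from left to right. *)
Definition affine (F : fieldType) := {p : F * F | p.1 != 0}.
HB.instance Definition _ (F : fieldType) := Choice.on (affine F).

Variable F : fieldType.
Implicit Types x y z : affine F.

Fact affine_mul_subproof x y : (val x).1 * (val y).1 != 0.
Proof. by rewrite mulf_neq0 ?(valP x) ?(valP y). Qed.
Definition affine_mul x y : affine F :=
  exist _ ((val x).1 * (val y).1, (val x).2 * (val y).1 + (val y).2)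
    (affine_mul_subproof x y).

Fact affine_inv_subproof x : (val x).1^-1 != 0.
Proof. by rewrite invr_eq0 (valP x). Qed.
Definition affine_inv x : affine F :=
  exist _ ((val x).1^-1, - (val x).2 / (val x).1) (affine_inv_subproof x).

Definition affine_one : affine F := exist _ (1, 0) (oner_neq0 F).

Fact affine_mulA : associative affine_mul.
Proof. by move=> x y z; apply: val_inj; congr (_, _) => /=; ring. Qed.
Fact affine_mul1 : left_id affine_one affine_mul.
Proof. by move=> [[a b] a0]; apply: val_inj; congr (_, _) => /=; ring. Qed.
Fact affine_mulr1 : right_id affine_one affine_mul.
Proof. by move=> [[a b] a0]; apply: val_inj; congr (_, _) => /=; ring. Qed.
Fact affine_mulV : left_inverse affine_one affine_inv affine_mul.
Proof. by move=> [[a b] a0]; apply: val_inj; congr (_, _) => /=; field. Qed.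
Fact affine_mulrV : right_inverse affine_one affine_inv affine_mul.
Proof. by move=> [[a b] a0]; apply: val_inj; congr (_, _) => /=; field. Qed.

HB.instance Definition _ := isGroup.Build (affine F)
  affine_mulA affine_mul1 affine_mulr1 affine_mulV affine_mulrV.

(** Commuting means that the vectors [(a - 1, b)] of the two maps are linearly dependent. Only the
    identity has the zero vector, whence transitivity. *)
Lemma affine_commuteP x y :
  commute x y <-> (val x).2 * ((val y).1 - 1) = (val y).2 * ((val x).1 - 1).
Proof.
rewrite !mulrBr !mulr1; split=> [/(congr1 val)[_] /= E|E].
  by apply/eqP; rewrite subr_eq addrAC eq_sym subr_eq eq_sym; apply/eqP.
apply: val_inj; congr (_, _) => /=; first exact: mulrC.
by apply/eqP; rewrite -subr_eq addrAC E subrK.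
Qed.

Lemma affine_commutation_transitive : commutation_transitive (affine F).
Proof.
move=> x y z y1 /affine_commuteP xy /affine_commuteP yz; apply/affine_commuteP.
have {y1} : ((val y).1 - 1 != 0) || ((val y).2 != 0).
  apply: contraNT y1 => /norP[]; rewrite !negbK subr_eq0 => /eqP y1 /eqP y2.
  by apply/eqP/val_inj; rewrite [LHS]surjective_pairing y1 y2.
case/orP=> y0; apply: (mulfI y0).
  by rewrite mulrCA mulrA xy mulrAC yz mulrCA mulrA.
by rewrite mulrCA yz mulrCA xy mulrCA.
Qed.
End Affine.

Section WordEmbedding.
Import GRing.Theory Num.Theory.
Local Open Scope ring_scope.

Variable T : finType.
Implicit Types s t : seq T.

Fact word_affine_subproof s : (#|T|.+1)%:R ^+ size s != 0 :> rat.
Proof. by rewrite expf_neq0 // pnatr_eq0. Qed.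

(** This map appends the digits of [s] to a numeral, so concatenation becomes composition. *)
Definition word_affine s : affine rat :=
  exist _ ((#|T|.+1)%:R ^+ size s, (numeral s)%:R) (word_affine_subproof s).

Lemma word_affine_inj : injective word_affine.
Proof.
by move=> s t /(congr1 val)[_ /eqP]; rewrite eqr_nat => /eqP/numeral_inj.
Qed.

Lemma word_affine_cat s t : word_affine (s ++ t) = (word_affine s * word_affine t)%g.
Proof.
apply: val_inj; congr (_, _) => /=; first by rewrite size_cat exprD.
by rewrite numeral_cat natrD natrM natrX.
Qed.
End WordEmbedding.

(** * Independent choices at four nested levels *)

Section FourLevels.
Local Open Scope group_scope.

Definition intertwines (gT : groupType) (c d p : gT) := c * p = p * d.

(** The solutions of [c * p = p * d] form a coset of the centraliser of [c]. *)
Lemma intertwines_div (gT : groupType) (c d p q : gT) :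
  intertwines c d q -> intertwines c d p <-> commute c (p / q).
Proof.
rewrite /intertwines /commute => cq.
have -> : d = q^-1 * c * q by rewrite -mulgA cq mulKg.
split=> [cp|cpq]; first by rewrite mulgA cp !mulgA mulgK.
by apply: (@mulIg _ q^-1); rewrite -mulgA cpq !mulgA mulgK.
Qed.

Lemma intertwines_eq (gT : groupType) (a a' b b' p : gT) :
  intertwines (a^-1 * a') (b / b') p <-> a * p * b = a' * p * b'.
Proof.
rewrite /intertwines; split=> E.
  by apply: (@mulIg _ b'^-1); rewrite mulgK -!mulgA -E !mulgA mulgV mul1g.
apply: (@mulgI _ a); apply: (@mulIg _ b').
by rewrite !mulgA mulgV mul1g mulgVK E.
Qed.

Lemma commuteJ (gT : groupType) (x y c : gT) :
  commute x y <-> commute (x ^ c) (y ^ c).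
Proof.
by split=> [xy|]; rewrite /commute -!conjMg; [rewrite xy | move/conjg_inj].
Qed.

(* Let [h b2 b3] be the quotient of the inner words with choices [(b2, b3)] and
   [(false, false)].  The conjugates of [h true true] and [h false true] by
   [l1 false] commute with [c], hence these two elements commute with each other;
   so do their conjugates by [l1 true], one of which is known to commute with [c]. *)
Lemma intertwines_two_levels (gT : groupType) (l1 l2 r1 r2 u : bool -> gT) c d :
  commutation_transitive gT ->
  let p b1 b2 b3 := l1 b1 * (l2 b2 * u b3 * r2 b2) * r1 b1 in
  (forall b1 b2 b3, ~~ [&& b1, b2 & b3] -> intertwines c d (p b1 b2 b3)) ->
  intertwines c d (p true true true).
Proof.
move=> ct p itw.
case: (eqVneq c 1) => [c1|c1].
  have := itw false false false isT.
  rewrite /intertwines c1 mul1g -{1}[p _ _ _]mulg1 => /mulgI <-.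
  by rewrite mul1g mulg1.
pose q b2 b3 := l2 b2 * u b3 * r2 b2.
pose h b2 b3 := q b2 b3 / q false false.
have hE b1 b2 b3 : p b1 b2 b3 / p b1 false false = h b2 b3 ^ (l1 b1)^-1.
  by rewrite /p /h /conjg -/(q b2 b3) -/(q false false) invgK !invgM !mulgA mulgK.
have itwE b1 b2 b3 :
    intertwines c d (p b1 b2 b3) <-> commute c (h b2 b3 ^ (l1 b1)^-1).
  by rewrite -hE; apply: intertwines_div; apply: itw; rewrite /= andbF.
(* If this quotient is trivial, then [u true = u false] and the third choice is immaterial. *)
case: (eqVneq (h false true) 1) => [/divg1_eq/mulIg/mulgI u_eq|h1].
  by have := itw true true false isT; rewrite /p u_eq.
have hh : commute (h true true) (h false true).
  apply/(commuteJ _ _ (l1 false)^-1); apply: (ct _ c) => //.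
    by apply: commute_sym; apply/itwE/itw.
  by apply/itwE/itw.
apply/itwE; apply: (ct _ (h false true ^ (l1 true)^-1)).
- by rewrite conjg_eq1.
- by apply/itwE/itw.
- by apply: commute_sym; apply: (proj1 (commuteJ _ _ _)).
Qed.

(** Comparing the two outermost choices eliminates the primed inner word: what remains says that [q]
    intertwines two fixed elements. *)
Lemma four_levels_group (gT : groupType)
    (l1 l2 l3 r1 r2 r3 u l1' l2' l3' r1' r2' r3' u' : bool -> gT) :
  commutation_transitive gT ->
  let p b1 b2 b3 b4 :=
    l1 b1 * (l2 b2 * (l3 b3 * u b4 * r3 b3) * r2 b2) * r1 b1 in
  let p' b1 b2 b3 b4 :=
    l1' b1 * (l2' b2 * (l3' b3 * u' b4 * r3' b3) * r2' b2) * r1' b1 in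
  (forall b1 b2 b3 b4, ~~ [&& b1, b2, b3 & b4] -> p b1 b2 b3 b4 = p' b1 b2 b3 b4) ->
  p true true true true = p' true true true true.
Proof.
move=> ct p p' pp'.
pose q b2 b3 b4 := l2 b2 * (l3 b3 * u b4 * r3 b3) * r2 b2.
pose q' b2 b3 b4 := l2' b2 * (l3' b3 * u' b4 * r3' b3) * r2' b2.
pose a b1 := (l1' b1)^-1 * l1 b1; pose b b1 := r1 b1 / r1' b1.
have qE b1 b2 b3 b4 :
    p b1 b2 b3 b4 = p' b1 b2 b3 b4 <-> a b1 * q b2 b3 b4 * b b1 = q' b2 b3 b4.
  rewrite /p /p' -/(q b2 b3 b4) -/(q' b2 b3 b4) /a /b; split=> E.
    by apply: (@mulgI _ (l1' b1)); apply: (@mulIg _ (r1' b1)); rewrite -E !mulgA mulgV mul1g mulgVK.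
  by rewrite -E !mulgA mulgV mul1g mulgVK.
have itwE b2 b3 b4 :
    intertwines ((a true)^-1 * a false) (b true / b false) (q b2 b3 b4) <->
    a true * q b2 b3 b4 * b true = a false * q b2 b3 b4 * b false.
  exact: intertwines_eq.
apply/qE; rewrite -(proj1 (qE false true true true) (pp' false true true true isT)).
apply/itwE/intertwines_two_levels => // b2 b3 b4 b234.
by apply/itwE; transitivity (q' b2 b3 b4); [|symmetry]; apply/qE/pp'.
Qed.

Lemma four_levels (Sigma Gamma : finType) (f g : seq Sigma -> seq Gamma)
    (l1 l2 l3 r1 r2 r3 u : bool -> seq Sigma) :
  is_morphism f -> is_morphism g ->
  let w b1 b2 b3 b4 :=
    l1 b1 ++ (l2 b2 ++ (l3 b3 ++ u b4 ++ r3 b3) ++ r2 b2) ++ r1 b1 in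
  (forall b1 b2 b3 b4, ~~ [&& b1, b2, b3 & b4] ->
    f (w b1 b2 b3 b4) = g (w b1 b2 b3 b4)) ->
  f (w true true true true) = g (w true true true true).
Proof.
move=> [_ fM] [_ gM] w fg; apply: word_affine_inj.
pose e h (x : bool -> seq Sigma) b : affine rat := word_affine (h (x b) : seq Gamma).
have := @four_levels_group _ (e f l1) (e f l2) (e f l3) (e f r1) (e f r2) (e f r3)
  (e f u) (e g l1) (e g l2) (e g l3) (e g r1) (e g r2) (e g r3) (e g u).
rewrite /w !(fM, gM, word_affine_cat) /e -!mulgA; apply; first exact: affine_commutation_transitive.
move=> b1 b2 b3 b4 /fg /(congr1 (@word_affine _)).
by rewrite /w !(fM, gM, word_affine_cat) -!mulgA.
Qed.
End FourLevels.

(** * Walks in finite labelled graphs *)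

Section Walks.
Variables (V : eqType) (E Sigma : finType) (src tgt : E -> V).
Variable lab : E -> seq Sigma * seq Sigma.
Implicit Types (a b c : V) (p q : seq E).

Fixpoint walk a p b : bool :=
  if p is e :: p' then (src e == a) && walk (tgt e) p' b else a == b.

Lemma walk_cat a b c p q : walk a p b -> walk b q c -> walk a (p ++ q) c.
Proof.
elim: p a => [|e p IH] a /=; first by move/eqP->.
by case/andP=> -> /IH.
Qed.

Lemma walk_rcons a b p e : walk a (rcons p e) b = walk a p (src e) && (tgt e == b).
Proof.
elim: p a => [|e' p IH] a /=; first by rewrite eq_sym.
by rewrite IH andbA.
Qed.

(** Each edge wraps its label around the word of the remaining walk, so right labels are read
    backwards. *)
Definition lefts p := flatten [seq (lab e).1 | e <- p].
Definition rights p := flatten (rev [seq (lab e).2 | e <- p]).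
Definition yield p := lefts p ++ rights p.

Lemma lefts_cat p q : lefts (p ++ q) = lefts p ++ lefts q.
Proof. by rewrite /lefts map_cat flatten_cat. Qed.

Lemma rights_cat p q : rights (p ++ q) = rights q ++ rights p.
Proof. by rewrite /rights map_cat rev_cat flatten_cat. Qed.

Lemma yield_cons e p : yield (e :: p) = (lab e).1 ++ yield p ++ (lab e).2.
Proof. by rewrite /yield -cat1s lefts_cat rights_cat /lefts /rights /= !cats0 !catA. Qed.

(** Where no walk joins [a] to [b], the value [d a b] is arbitrary. *)
Definition least_walks (d : V -> V -> seq E) := forall a b p,
  walk a p b -> walk a (d a b) b /\ numeral (d a b) <= numeral p.

Lemma least_walks_exist : exists d, least_walks d.
Proof.
have least (ab : V * V) : exists q, forall p, walk ab.1 p ab.2 ->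
    walk ab.1 q ab.2 /\ numeral q <= numeral p.
  case: ab => a b /=.
  case: (pselect (exists n, `[< exists2 p, walk a p b & numeral p = n >])).
    move=> ex; case: (ex_minnP ex) => _ /asboolP[q wq <-] q_min.
    by exists q => p wp; split=> //; apply: q_min; apply/asboolP; exists p.
  by move=> no; exists [::] => p wp; case: no; exists (numeral p); apply/asboolP; exists p.
have [d dP] := choice least.
by exists (fun a b => d (a, b)) => a b p; apply: (dP (a, b)).
Qed.

Section LeastWalks.
Variable d : V -> V -> seq E.
Hypothesis dP : least_walks d.

Lemma least_walk_lt a b p : walk a p b -> p != d a b -> numeral (d a b) < numeral p.
Proof.
move=> wp ne; rewrite ltn_neqAle (dP wp).2 andbT.
by apply: contraNneq ne => /numeral_inj->.
Qed.

(** The shortest non-least prefix is a least walk followed by one edge. *)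
Lemma walk_first_nonleast a b p : walk a p b ->
  p = d a b \/ exists e q, [/\ p = rcons (d a (src e)) e ++ q,
    walk a (rcons (d a (src e)) e) (tgt e), walk (tgt e) q b &
    rcons (d a (src e)) e != d a (tgt e)].
Proof.
elim/last_ind: p b => [|p e IH] b.
  move=> wn; left; have [_] := dP wn; rewrite leqn0 => /eqP E0.
  by apply: numeral_inj; rewrite E0.
rewrite walk_rcons => /andP[wp /eqP<-].
case: (IH _ wp) => [pE | [e' [q [-> w1 w2 ne]]]].
  case: (eqVneq (rcons p e) (d a (tgt e))) => [|ne]; first by left.
  right; exists e, [::]; rewrite -pE cats0; split=> //=.
  by rewrite walk_rcons wp eqxx.
right; exists e', (rcons q e); split=> //; first by rewrite rcons_cat.
by rewrite walk_rcons w2 eqxx.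
Qed.

(** The edges in [es] determine the walk, which bounds the number of such walks by a power of
    [#|E|]. *)
Fixpoint detour a es b :=
  if es is e :: es' then rcons (d a (src e)) e ++ detour (tgt e) es' b else d a b.

Definition segment a (c : bool -> seq E) b :=
  (forall x, walk a (c x) b) /\ numeral (c false) < numeral (c true).

Lemma segment_least a b p : walk a p b -> p != d a b ->
  segment a (fun x => if x then p else d a b) b.
Proof.
move=> wp ne; split; last exact: least_walk_lt.
by case=> //; have [] := dP wp.
Qed.

Lemma segment_leqif a (c : bool -> seq E) b x :
  segment a c b -> numeral (c x) <= numeral (c true) ?= iff x.
Proof.
case=> _ lt_c; case: x; first exact: leqif_refl.
by split; [exact: ltnW | exact: ltn_eqF].
Qed.

(** Labels nest, so the four segments act as four nested levels; each of the 15 other combinations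
    is a strictly smaller walk with the same ends. *)
Lemma four_segments (Gamma : finType) (f g : seq Sigma -> seq Gamma)
    a0 a1 a2 a3 a4 (c1 c2 c3 c4 : bool -> seq E) :
  is_morphism f -> is_morphism g ->
  segment a0 c1 a1 -> segment a1 c2 a2 -> segment a2 c3 a3 -> segment a3 c4 a4 ->
  let p := c1 true ++ c2 true ++ c3 true ++ c4 true in
  (forall q, walk a0 q a4 -> numeral q < numeral p -> f (yield q) = g (yield q)) ->
  f (yield p) = g (yield p).
Proof.
move=> fM gM s1 s2 s3 s4 p fg.
pose q x1 x2 x3 x4 := c1 x1 ++ c2 x2 ++ c3 x3 ++ c4 x4.
have yieldE x1 x2 x3 x4 : yield (q x1 x2 x3 x4) =
    lefts (c1 x1) ++ (lefts (c2 x2) ++ (lefts (c3 x3) ++ yield (c4 x4) ++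
      rights (c3 x3)) ++ rights (c2 x2)) ++ rights (c1 x1).
  by rewrite /yield /q !lefts_cat !rights_cat !catA.
rewrite (yieldE true true true true).
apply: (four_levels (l1 := fun x => lefts (c1 x)) (l2 := fun x => lefts (c2 x))
  (l3 := fun x => lefts (c3 x)) (u := fun x => yield (c4 x))
  (r1 := fun x => rights (c1 x)) (r2 := fun x => rights (c2 x))
  (r3 := fun x => rights (c3 x)) fM gM) => x1 x2 x3 x4 nx.
rewrite -yieldE; apply: fg.
  by apply: walk_cat (s1.1 _) (walk_cat (s2.1 _) (walk_cat (s3.1 _) (s4.1 _))).
have le_p : numeral (q x1 x2 x3 x4) <= numeral p ?= iff [&& x1, x2, x3 & x4].
  have seg4 := numeral_leqif_cat (segment_leqif x3 s3) (segment_leqif x4 s4).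
  exact: numeral_leqif_cat (segment_leqif x1 s1) (numeral_leqif_cat (segment_leqif x2 s2) seg4).
by rewrite (ltn_leqif le_p).
Qed.

End LeastWalks.

Lemma walks_test_set a b : exists T : seq (seq Sigma),
  [/\ forall w, w \in T -> exists2 p, walk a p b & w = yield p,
      size T <= \sum_(k < 4) #|E| ^ k &
      forall (Gamma : finType) (f g : seq Sigma -> seq Gamma),
        is_morphism f -> is_morphism g -> {in T, f =1 g} ->
        forall p, walk a p b -> f (yield p) = g (yield p)].
Proof.
have [d dP] := least_walks_exist.
pose I := [seq val t | k <- iota 0 4, t <- enum {: k.-tuple E}].
have mem_I es : size es < 4 -> es \in I.
  move=> es4; apply/allpairsPdep; exists (size es), (in_tuple es).
  by rewrite mem_iota mem_enum.
(* Arbitrary edges need not fit together; the filter keeps the lists that give walks. *)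
exists [seq yield (detour d a es b) | es <- I & walk a (detour d a es b) b]; split.
- move=> w /mapP[es]; rewrite mem_filter => /andP[wes _ ->].
  by exists (detour d a es b).
- rewrite size_map size_filter (leq_trans (count_size _ _)) //.
  rewrite size_allpairs_dep sumnE big_map.
  rewrite -[iota 0 4]/(index_iota 0 4) big_mkord leq_eqVlt; apply/orP; left.
  by apply/eqP/eq_bigr => k _; rewrite -cardE card_tuple.
move=> Gamma f g fM gM fg p.
(* Strong induction on the numeral of the walk. *)
have [n] := ubnP (numeral p); elim: n p => // n IH p /ltnSE le_pn wp.
have fgI es : size es < 4 -> p = detour d a es b -> f (yield p) = g (yield p).
  move=> es4 pE; apply: fg; apply/mapP; exists es; last by rewrite -pE.
  by rewrite mem_filter -pE wp mem_I.
case: (walk_first_nonleast dP wp) => [|[e1 [p1 [pE1 w1 wp1 ne1]]]]; first exact: (fgI [::]).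
case: (walk_first_nonleast dP wp1) => [pE|[e2 [p2 [pE2 w2 wp2 ne2]]]].
  by apply: (fgI [:: e1]); rewrite //= pE1 pE.
case: (walk_first_nonleast dP wp2) => [pE|[e3 [p3 [pE3 w3 wp3 ne3]]]].
  by apply: (fgI [:: e1; e2]); rewrite //= pE1 pE2 pE.
(* The whole remainder serves as the fourth segment unless it is least. *)
case: (eqVneq p3 (d (tgt e3) b)) => [pE|ne4].
  by apply: (fgI [:: e1; e2; e3]); rewrite //= pE1 pE2 pE3 pE.
have := four_segments fM gM (segment_least dP w1 ne1) (segment_least dP w2 ne2)
  (segment_least dP w3 ne3) (segment_least dP wp3 ne4).
rewrite /= -pE3 -pE2 -pE1; apply=> q wq lt_qp.
by apply: IH => //; apply: leq_trans lt_qp le_pn.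
Qed.
End Walks.

(** In the group, three corners of a rectangle of products determine the fourth. *)
Lemma morphism_exchange (Sigma Gamma : finType) (f g : seq Sigma -> seq Gamma) x x' y y' :
  is_morphism f -> is_morphism g ->
  f (x ++ y') = g (x ++ y') -> f (x' ++ y') = g (x' ++ y') ->
  f (x' ++ y) = g (x' ++ y) -> f (x ++ y) = g (x ++ y).
Proof.
move=> [_ fM] [_ gM]; rewrite !(fM, gM).
move=> /(congr1 (@word_affine _)) E1 /(congr1 (@word_affine _)) E2.
move=> /(congr1 (@word_affine _)) E3; apply: word_affine_inj.
move: E1 E2 E3; rewrite !word_affine_cat.
set a := word_affine (f x); set a' := word_affine (f x').
set b := word_affine (f y); set b' := word_affine (f y').
set c := word_affine (g x); set c' := word_affine (g x').
set e := word_affine (g y); set e' := word_affine (g y').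
have rect (u u' v v' : affine rat) : (u * v = u * v' * (u' * v')^-1 * (u' * v))%g.
  by rewrite invgM !mulgA mulgK mulgVK.
by move=> E1 E2 E3; rewrite (rect a a' b b') E1 E2 E3 -rect.
Qed.

(** * From context-free to linear grammars *)

Section Grammar.
Variables (N Sigma : finType) (G : cfg N Sigma).
Implicit Types (s t : seq (N + Sigma)) (u v w : seq Sigma) (A B : N).

(** Derivation trees in place of rewriting sequences, so that induction can follow the tree. *)
Inductive generates : seq (N + Sigma) -> seq Sigma -> Prop :=
| Gen_nil : generates [::] [::]
| Gen_terminal a s w : generates s w -> generates (inr a :: s) (a :: w)
| Gen_prod A rhs s u w : (A, rhs) \in prods G -> generates rhs u ->
    generates s w -> generates (inl A :: s) (u ++ w).

Lemma generates_cat s t u w :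
  generates s u -> generates t w -> generates (s ++ t) (u ++ w).
Proof.
move=> gs gt; elim: gs => //= [a s' u' _|A rhs s' u1 u2 Ar gr _ _] IH.
  exact: Gen_terminal.
by rewrite -catA; apply: Gen_prod Ar gr IH.
Qed.

Lemma generates_cat_inv s t w : generates (s ++ t) w ->
  exists u v, [/\ w = u ++ v, generates s u & generates t v].
Proof.
elim: s w => [|[A|a] s IH] w; first by exists [::], w; split=> //; constructor.
  move=> /= gw; inversion gw as [| |A' rhs s' u1 u2 Ar gr gs]; subst.
  have [u [v [-> gu gv]]] := IH _ gs.
  by exists (u1 ++ u), v; rewrite catA; split=> //; apply: Gen_prod Ar gr gu.
move=> /= gw; inversion gw as [|a' s' w' gs|]; subst.
have [u [v [-> gu gv]]] := IH _ gs.
by exists (a :: u), v; split=> //; apply: Gen_terminal.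
Qed.

Lemma generates_terminals w : generates (map inr w) w.
Proof. by elim: w => [|a w IH]; constructor. Qed.

Lemma generates_prod A rhs w :
  (A, rhs) \in prods G -> generates rhs w -> generates [:: inl A] w.
Proof. by move=> Ar gr; rewrite -[w]cats0; apply: Gen_prod Ar gr Gen_nil. Qed.

Lemma generates_derives s w : generates s w -> cfg_derives G s (map inr w).
Proof.
have ctx x y s1 s2 : cfg_derives G s1 s2 -> cfg_derives G (x ++ s1 ++ y) (x ++ s2 ++ y).
  elim=> [_ _ [x' [y' [A [rhs [Ar [-> ->]]]]]]|?|? s0 ? _ IH1 _ IH2].
  - by apply: rt_step; exists (x ++ x'), (y' ++ y), A, rhs; rewrite -!catA.
  - exact: rt_refl.
  - exact: rt_trans IH1 IH2.
elim=> [|a s' w' _ IH|A rhs s' u1 u2 Ar _ IHr _ IHs] /=; first exact: rt_refl.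
  by have := ctx [:: inr a] [::] _ _ IH; rewrite !cats0.
apply: rt_trans (_ : cfg_derives G _ (rhs ++ s')) _.
  by apply: rt_step; exists [::], s', A, rhs.
apply: rt_trans (ctx [::] s' _ _ IHr) _; rewrite map_cat.
by have := ctx (map inr u1) [::] _ _ IHs; rewrite !cats0.
Qed.

Lemma derives_generates s w : cfg_derives G s (map inr w) -> generates s w.
Proof.
move=> /clos_rt_rt1n_iff; move E: (map _ w) => t der.
elim: der E => [s' <-|s1 s2 s3 [x [y [A [rhs [Ar [-> ->]]]]]] _ IH E].
  exact: generates_terminals.
have [u [v [-> gx /generates_cat_inv[u1 [u2 [-> gr gy]]]]]] := generates_cat_inv (IH E).
by apply: generates_cat gx _; apply: Gen_prod Ar gr gy.
Qed.

Lemma cfg_langE w : cfg_lang G w <-> generates [:: inl (start G)] w.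
Proof. by split=> [/derives_generates|/generates_derives]. Qed.

Definition default_words (d : N -> seq Sigma) :=
  forall A w, generates [:: inl A] w -> generates [:: inl A] (d A).

Lemma default_words_exist : exists d, default_words d.
Proof.
have [A|d dP] := @choice N (seq Sigma) (fun A v => forall w,
    generates [:: inl A] w -> generates [:: inl A] v); last by exists d.
case: (pselect (exists w, generates [:: inl A] w)) => [[v gv]|no]; first by exists v.
by exists [::] => w gw; case: no; exists w.
Qed.

(** * Linearising the grammar by default words *)

Section DefaultWords.
Variable d : N -> seq Sigma.
Variable dP : default_words d.

Definition fill s : seq Sigma :=
  flatten [seq match x with inl A => d A | inr a => [:: a] end | x <- s].

Lemma generates_fill s w : generates s w -> generates s (fill s).
Proof.
elim=> [|a s' w' _ IH|A rhs s' u1 u2 Ar gr _ _ IH]; first exact: Gen_nil.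
  exact: Gen_terminal.
by apply: (@generates_cat [:: inl A]) IH; apply: dP; apply: generates_prod Ar gr.
Qed.

(* [None] is the vertex reached once no nonterminal is left. *)
Definition branch (r : N * seq (N + Sigma)) i :=
  if drop i r.2 is inl B :: y
  then Some (Some r.1, (fill (take i r.2), fill y), Some B) else None.

Definition branches (r : N * seq (N + Sigma)) :
    seq (option N * (seq Sigma * seq Sigma) * option N) :=
  (Some r.1, (fill r.2, [::]), None) :: pmap (branch r) (iota 0 (size r.2)).

(** Restricting to these productions ensures that every default word filled in is really
    generated. *)
Definition productive (r : N * seq (N + Sigma)) := `[< exists u, generates r.2 u >].

Definition linear_branches :=
  flatten [seq branches r | r <- prods G & productive r].

(** A production yields one branch without nonterminal and at most one per symbol of its right-hand
    side, hence the summand [|rhs| + 1]. *)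
Lemma size_linear_branches : size linear_branches <= cfg_size G.
Proof.
rewrite /linear_branches /cfg_size; elim: (prods G) => [|r rs IH] /=.
  by rewrite big_nil.
rewrite big_cons; case: (productive r) => /=; last exact: leq_trans IH (leq_addl _ _).
by rewrite size_cat -addSn leq_add // ltnS size_pmap (leq_trans (count_size _ _)) ?size_iota.
Qed.

Lemma linear_branchesP e : e \in linear_branches <->
  exists A rhs w, [/\ (A, rhs) \in prods G, generates rhs w &
    e = (Some A, (fill rhs, [::]), None) \/
    exists x B y, rhs = x ++ inl B :: y /\
      e = (Some A, (fill x, fill y), Some B)].
Proof.
split.
  move=> /flatten_mapP[[A rhs]]; rewrite mem_filter => /andP[/asboolP[w gw] Ar].
  rewrite inE => e_in; exists A, rhs, w; split=> //=.
  case/orP: e_in => [/eqP|]; first by left.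
  rewrite mem_pmap => /mapP[i _] /=; rewrite /branch /=.
  case E: (drop i rhs) => [|[B|//] y] // [->]; right.
  by exists (take i rhs), B, y; rewrite -E cat_take_drop.
move=> [A [rhs [w [Ar gw e_eq]]]]; apply/flatten_mapP; exists (A, rhs).
  by rewrite mem_filter Ar andbT; apply/asboolP; exists w.
rewrite inE; case: e_eq => [->|[x [B [y [E ->]]]]]; first by rewrite eqxx.
apply/orP; right; rewrite mem_pmap; apply/mapP; exists (size x).
  by rewrite mem_iota /= E size_cat /= addnS ltnS leq_addr.
by rewrite /branch /= E drop_size_cat // take_size_cat.
Qed.

Let E := 'I_(size linear_branches).
Let edge (i : E) := tnth (in_tuple linear_branches) i.
Let src (i : E) := (edge i).1.1.
Let tgt (i : E) := (edge i).2.
Let lab (i : E) := (edge i).1.2.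
Let steps := walk src tgt.

Lemma steps_rcons a p b c i :
  steps a p b -> src i = b -> tgt i = c -> steps a (rcons p i) c.
Proof. by rewrite /steps walk_rcons => wp -> ->; rewrite wp eqxx. Qed.

Lemma walk_generates A p : steps (Some A) p None -> generates [:: inl A] (yield lab p).
Proof.
elim: p A => [|i p IH] A //= /andP[/eqP src_i].
have /linear_branchesP[A' [rhs [w [Ar gw e_eq]]]] : edge i \in linear_branches.
  exact: mem_tnth.
rewrite yield_cons; case: e_eq => [e_eq|[x [B [y [rhs_eq e_eq]]]]].
  move: src_i; rewrite /src /tgt /lab e_eq /= => -[<-].
  (* No edge leaves [None], so the walk ends here. *)
  case: p IH => [_ _|j p _] /=.
    by rewrite !cats0; apply: generates_prod Ar (generates_fill gw).
  have /linear_branchesP[A2 [r2 [w2 [_ _ []]]]] := mem_tnth j (in_tuple linear_branches).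
    by rewrite /src /edge => ->.
  by move=> [? [? [? [_ e2]]]]; rewrite /src /edge e2.
move: src_i; rewrite /src /tgt /lab e_eq /= => -[<-] /IH gB.
apply: generates_prod Ar _; subst rhs.
have [u [v [_ gx]]] := generates_cat_inv gw.
rewrite -cat1s => /generates_cat_inv[u1 [v1 [_ _ gy]]].
by apply: generates_cat (generates_fill gx) (generates_cat gB (generates_fill gy)).
Qed.

(** * Transfer of agreement from the linear grammar to the language *)

Section Agreement.
Variables (Gamma : finType) (f g : seq Sigma -> seq Gamma).
Variables (fM : is_morphism f) (gM : is_morphism g).
Variable fg : forall p, steps (Some (start G)) p None ->
  f (yield lab p) = g (yield lab p).

Definition reaches A l r :=
  exists p, [/\ steps (Some (start G)) p (Some A), lefts lab p = l & rights lab p = r].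

Lemma reaches_prod A rhs l r w : (A, rhs) \in prods G -> generates rhs w ->
  reaches A l r ->
  f (l ++ fill rhs ++ r) = g (l ++ fill rhs ++ r) /\
  forall x B y, rhs = x ++ inl B :: y -> reaches B (l ++ fill x) (fill y ++ r).
Proof.
move=> Ar gw [p [wp <- <-]].
have edgeP e : e \in linear_branches -> exists i, edge i = e.
  by move=> /(@tnthP _ _ (in_tuple linear_branches))[i ->]; exists i.
split=> [|x B y rhs_eq].
  have [|i ei] := edgeP (Some A, (fill rhs, [::]), None).
    by apply/linear_branchesP; exists A, rhs, w; split=> //; left.
  have := fg (p := rcons p i); rewrite /yield -cats1 lefts_cat rights_cat.
  rewrite /lefts /rights /= /lab ei /= !cats0 -catA; apply.
  by rewrite cats1; apply: steps_rcons wp _ _; rewrite /src /tgt ei.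
have [|i ei] := edgeP (Some A, (fill x, fill y), Some B).
  by apply/linear_branchesP; exists A, rhs, w; split=> //; right; exists x, B, y.
exists (rcons p i); rewrite -cats1 lefts_cat rights_cat /lefts /rights /= /lab ei /=.
rewrite !cats0; split=> //.
by rewrite cats1; apply: steps_rcons wp _ _; rewrite /src /tgt ei.
Qed.

(** Induction on the tree replaces default words by the generated ones; every nonterminal of [s] is
    reachable in the context where its neighbours are filled. *)
Lemma agree_generates s w l r : generates s w ->
  (forall x A y, s = x ++ inl A :: y -> reaches A (l ++ fill x) (fill y ++ r)) ->
  f (l ++ fill s ++ r) = g (l ++ fill s ++ r) -> f (l ++ w ++ r) = g (l ++ w ++ r).
Proof.
move=> gs; elim: gs l r => [|a s' w' _ IH|A rhs s' u1 u2 Ar gr IHr gs IHs] l r // ctx.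
  have consE v : l ++ (a :: v) ++ r = (l ++ [:: a]) ++ v ++ r by rewrite -catA.
  rewrite -[fill _]/(a :: fill s') !consE => fgs; apply: IH => // x A y s_eq.
  by have := ctx (inr a :: x) A y; rewrite s_eq -catA; apply.
rewrite -[fill _]/(d A ++ fill s') -!catA !(catA l) => fgs.
have reachA : reaches A l (fill s' ++ r).
  by have := ctx [::] A s' erefl; rewrite cats0.
have [fg_rhs reach_rhs] := reaches_prod Ar gr reachA.
(* The known corners replace only the head, nothing, or only the tail by its generated word. *)
apply: (morphism_exchange (x' := l ++ d A) (y' := fill s' ++ r)) => //.
  by rewrite -catA; apply: IHr.
apply: IHs => // x B y s_eq.
by have := ctx (inl A :: x) B y; rewrite s_eq -catA; apply.
Qed.

Lemma agree_lang w : cfg_lang G w -> f w = g w.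
Proof.
move=> /cfg_langE gw; inversion gw as [| |A rhs s u1 u2 Ar gr gs]; subst.
inversion gs; rewrite cats0.
have [|fg_rhs reach_rhs] := reaches_prod Ar gr (l := [::]) (r := [::]).
  by exists [::]; split=> //; exact: eqxx.
by have := agree_generates gr reach_rhs fg_rhs; rewrite cats0.
Qed.
End Agreement.
End DefaultWords.

(** * The test set and its size *)

Lemma cfg_test_set : exists T : seq (seq Sigma),
  is_test_set (cfg_lang G) T /\ size T <= \sum_(k < 4) cfg_size G ^ k.
Proof.
have [d dP] := default_words_exist.
pose edge := tnth (in_tuple (linear_branches d)).
have [T [T_walk sT TP]] := walks_test_set (fun i => (edge i).1.1) (fun i => (edge i).2)
  (fun i => (edge i).1.2) (Some (start G)) None.
exists T; split; last first.
  apply: leq_trans sT _; apply: leq_sum => k _; rewrite card_ord.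
  by case: k => -[|k] //= _; rewrite leq_exp2r // size_linear_branches.
split=> [w /T_walk[p wp ->]|Gamma f g fM gM fgT w].
  exact/cfg_langE/(walk_generates dP).
by apply: (agree_lang (d := d) fM gM) => p wp; apply: TP.
Qed.

Lemma small_cfg_lang w : cfg_size G <= 1 -> cfg_lang G w -> w = [::].
Proof.
move=> size_G /cfg_langE.
have rhs0 A rhs : (A, rhs) \in prods G -> rhs = [::].
  move=> Ar; apply: size0nil; apply/eqP; rewrite -leqn0 -ltnS; apply: leq_trans size_G.
  by rewrite /cfg_size (big_rem _ Ar) leq_addr.
move=> gw; inversion gw as [| |A rhs s u1 u2 Ar gr gs]; subst; inversion gs.
by rewrite cats0; move: gr; rewrite (rhs0 _ _ Ar) => gr; inversion gr.
Qed.
End Grammar.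

Theorem theorem2 (N Sigma : finType) (G : cfg N Sigma) :
  uniq (prods G) ->
  exists T : seq (seq Sigma),
    is_test_set (cfg_lang G) T /\ size T <= 2 * cfg_size G ^ 3.
Proof.
(* The inequality [1 + n + n^2 + n^3 <= 2 * n^3] starts at [n = 2], with [15 <= 16]. Below that the
   language contains at most the empty word, and the empty test set suffices. *)
move=> _; have [small|large] := leqP (cfg_size G) 1.
  exists [::]; split=> //; split=> // Gamma f g [f0 _] [g0 _] _ w.
  by move=> /(small_cfg_lang small) ->; rewrite f0 g0.
have [T [TP sT]] := cfg_test_set G; exists T; split=> //.
apply: leq_trans sT _; rewrite !big_ord_recl big_ord0 /=.
rewrite /bump /=; nia.
Qed.
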